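(* There is a family $\{G^{(n)}\}$ of deterministic presentations such that, for all sufficiently large $n$, $G^{(n)}$ has $n$ vertices and the minimum length of a synchronizing word for $G^{(n)}$ is $2^{\Omega(n)}$.
   Context: A labeled graph has finite vertex and edge sets, edges with initial/terminal vertices and labels from a finite alphabet; a presentation is an essential labeled graph (every vertex has an incoming and an outgoing edge), and it is deterministic if no vertex has two outgoing edges with the same label. For deterministic $G$ with vertex set $Q_G$, $Q_G\cdot w$ is the set of end vertices of paths labeled $w$ (starting anywhere); $w$ is synchronizing for $G$ if $|Q_G\cdot w|=1$. *)

(* Defs.v *)
From mathcomp Require Import all_boot.

Set Implicit Arguments.
Unset Strict Implicit.
Unset Printing Implicit Defensive.

(* Each graph carries its own finite alphabet; parallel edges are allowed. *)
Record labeled_graph := LabeledGraph {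
  vertex : finType;
  edge : finType;
  letter : finType;
  init : edge -> vertex;
  term : edge -> vertex;
  label : edge -> letter
}.

Definition essential (G : labeled_graph) : Prop :=
  forall q : vertex G, (exists e, term e = q) /\ (exists e, init e = q).

Definition deterministic (G : labeled_graph) : Prop :=
  forall e e' : edge G, init e = init e' -> label e = label e' -> e = e'.

Fixpoint is_path (G : labeled_graph) (q : vertex G) (p : seq (edge G)) : bool :=
  if p is e :: p' then (init e == q) && is_path (term e) p' else true.

Definition path_end (G : labeled_graph) (q : vertex G) (p : seq (edge G)) :
  vertex G := last q (map (@term G) p).

(* Q_G . w.  A path labeled w has exactly size w edges, so it can be
   quantified over the finite type of tuples of that length. *)
Definition end_vertices (G : labeled_graph) (w : seq (letter G)) :
  {set vertex G} :=
  [set r | [exists q : vertex G, exists p : (size w).-tuple (edge G),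
     [&& is_path q p, map (@label G) p == w & path_end q p == r]]].

Definition synchronizing (G : labeled_graph) (w : seq (letter G)) : bool :=
  #|end_vertices w| == 1.

Definition is_min_sync_length (G : labeled_graph) (m : nat) : Prop :=
  (exists2 w : seq (letter G), synchronizing w & size w = m) /\
  (forall w : seq (letter G), synchronizing w -> m <= size w).

(* Main.v *)
(* The shortest word is forced to drive a counter through [2 ^ k] values.  Each
   of [k] columns is in a state of type [option bool], and the successive
   values of the counter are all the maps from columns to [bool].  The letter
   [Some (inr j)] advances every column agreeing with the [j]-th value and sends the
   others to the failure state [None]; a failed column only recovers through a
   reset of all the columns to the first value.  The letter [None] kills exactly
   the column states agreeing with the last value; it sends the other ones to a
   sink that can be neither merged with, nor killed without, the sink reached
   from the base state.  Hence a synchronizing word reads [None] at a moment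
   when all the columns hold the last value, and by then the counter has gone
   through all its values. *)
Require Import Defs.
From mathcomp Require Import all_boot all_order all_algebra.
From mathcomp Require Import all_classical all_reals all_analysis.
From mathcomp Require Import zify.
Import Order.TTheory GRing.Theory Num.Theory numFieldNormedType.Exports.

Set Implicit Arguments.
Unset Strict Implicit.
Unset Printing Implicit Defensive.

(** * Labeled graphs of partial automata *)

Section PartialAutomaton.
Variables (V A : finType) (d : V -> A -> option V).

Definition automaton_edge := {x : V * A * V | d x.1.1 x.1.2 == Some x.2}.

Definition automaton_graph : labeled_graph :=
  @LabeledGraph V automaton_edge A (fun e => (val e).1.1)
    (fun e => (val e).2) (fun e => (val e).1.2).

Fixpoint run (q : V) (w : seq A) : option V :=
  if w is a :: w' then obind (run^~ w') (d q a) else Some q.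

Lemma run_cat q u w : run q (u ++ w) = obind (run^~ w) (run q u).
Proof. by elim: u q => //= a u IHu q; case: (d q a). Qed.

Lemma automaton_deterministic : deterministic automaton_graph.
Proof.
move=> [[[q a] r] dr] [[[q' a'] r'] dr'] /= eq_q eq_a; apply: val_inj => /=.
by move: dr dr'; rewrite /= eq_q eq_a => /eqP-> /eqP[->].
Qed.

Lemma automaton_essential :
  (forall q, exists q' a, d q' a = Some q) ->
  (forall q, exists a q', d q a = Some q') -> essential automaton_graph.
Proof.
move=> din dout q; split.
  have [q' [a /eqP dq]] := din q.
  by exists (exist _ (q', a, q) dq : edge automaton_graph).
have [a [q' /eqP dq]] := dout q.
by exists (exist _ (q, a, q') dq : edge automaton_graph).
Qed.

Lemma path_run q (p : seq (edge automaton_graph)) :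
  is_path q p -> run q (map (@label _) p) = Some (path_end q p).
Proof.
elim: p q => //= e p IHp q /andP[/eqP <- /IHp] /= {}IHp.
by rewrite (eqP (valP e)) /= IHp.
Qed.

Lemma run_path q w r : run q w = Some r ->
  exists p : seq (edge automaton_graph),
    [/\ @is_path automaton_graph q p, map (@label _) p = w &
      @path_end automaton_graph q p = r].
Proof.
elim: w q => [|a w IHw] q /=; first by move=> [<-]; exists [::].
case dq: (d q a) => [q'|] //= /IHw[p [pP lP eP]].
have dq' : d (q, a, q').1.1 (q, a, q').1.2 == Some (q, a, q').2 by apply/eqP.
exists ((exist _ (q, a, q') dq' : edge automaton_graph) :: p).
by split=> //=; [rewrite eqxx | rewrite lP].
Qed.

Lemma end_verticesP (w : seq A) r :
  reflect (exists q, run q w = Some r) (r \in @end_vertices automaton_graph w).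
Proof.
rewrite inE; apply: (iffP existsP) => [] [q].
  case/existsP=> p /and3P[pP /eqP lP /eqP eP].
  by exists q; rewrite -lP -eP; apply: path_run.
case/run_path=> p [pP lP eP]; exists q; apply/existsP.
have sz_p : size p == size w by rewrite -lP size_map.
by exists (Tuple sz_p); rewrite pP lP eP !eqxx.
Qed.

End PartialAutomaton.

(** * The counter graph and its synchronizing words *)

Section Counter.
Variables (I : finType) (i0 : I) (N p : nat).
Variable code : 'I_N.+1 -> {ffun I -> bool}.
Hypothesis code_inj : injective code.

(* [inl true] resets, [inl false] does nothing (it makes the graph essential),
   and [inr j] steps from the [j]-th value to the next one. *)
Definition command := (bool + 'I_N.+1)%type.

Definition move (i : I) (v : option bool) (x : command) : option bool :=
  match x with
  | inl true => Some (code ord0 i)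
  | inl false => v
  | inr j => if v == Some (code j i) then Some (code (ordS j) i) else None
  end.

Notation column u i v := (foldl (move i) v u).

Lemma column_value_bound u :
  (exists i v, column u i v = None) \/
  exists2 j : 'I_N.+1, j <= size u &
    forall i, exists v, column u i v = Some (code j i).
Proof.
elim/last_ind: u => [|u x IHu]; first by left; exists i0, None.
rewrite size_rcons; case: x => [[]|j].
- by right; exists ord0 => // i; exists None; rewrite foldl_rcons.
- case: IHu => [[i [v E]]|[j le_j E]].
    by left; exists i, v; rewrite foldl_rcons.
  right; exists j => [|i]; first exact: leqW.
  by have [v Ev] := E i; exists v; rewrite foldl_rcons.
case: IHu => [[i [v E]]|[j' le_j' E]].
  by left; exists i, v; rewrite foldl_rcons E.
have [<-|ne_j] := eqVneq j' j.
  right; exists (ordS j') => [|i].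
    (* [ordS] wraps from the last value to the first, which only lowers the index. *)
    by apply: leq_trans (leq_mod _ _) _.
  by have [v Ev] := E i; exists v; rewrite foldl_rcons Ev /= eqxx.
(* By injectivity of [code], a step letter for a wrong value disagrees with some column, which then
   fails. *)
have [i ne_i] : exists i, code j' i != code j i.
  apply/existsP; apply: contraNT ne_j; rewrite negb_exists => /forallP eq_c.
  by apply/eqP/code_inj/ffunP => i; apply/eqP; move: (eq_c i); rewrite negbK.
left; have [v Ev] := E i; exists i, v; rewrite foldl_rcons Ev /=.
by case: eqP => // -[eq_i]; rewrite eq_i eqxx in ne_i.
Qed.

Lemma column_last_size u :
  (forall i v, column u i v = Some (code ord_max i)) -> N <= size u.
Proof.
move=> last_u; have [[i [v]]|[j le_j Ej]] := column_value_bound u.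
  by rewrite last_u.
suff -> : N = j by [].
rewrite -[LHS]/(val (ord_max : 'I_N.+1)); congr val; apply: code_inj.
by apply/ffunP => i; have [v] := Ej i; rewrite last_u => -[].
Qed.

(** A reset followed by [j] successive steps works. Nonemptiness matters later: such a word also
    kills every sink. *)
Lemma column_reach (j : 'I_N.+1) :
  exists2 u, u != [::] & forall i v, column u i v = Some (code j i).
Proof.
case: j => j; elim: j => [|j IHj] lt_j.
  by exists [:: inl true] => // i v /=; congr (Some (code _ i)); apply: val_inj.
have [u _ Eu] := IHj (ltnW lt_j).
exists (rcons u (inr (Ordinal (ltnW lt_j)))) => [|i v].
  by rewrite -size_eq0 size_rcons.
rewrite foldl_rcons Eu /= eqxx; congr (Some (code _ i)).
by apply: val_inj; rewrite /= modn_small.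
Qed.

(* [inl None] is the base state and [inr ord0] the sink reached from it;
   the number [p] of idle sinks only adjusts the number of vertices. *)
Definition state := (option (I * option bool) + 'I_p.+2)%type.

Definition delta (q : state) (a : option command) : option state :=
  match a, q with
  | Some x, inl (Some (i, v)) => Some (inl (Some (i, move i v x)))
  | Some _, inl None => Some q
  | Some _, inr _ => None
  | None, inl (Some (i, v)) =>
      if v == Some (code ord_max i) then None else Some (inr ord_max)
  | None, inl None => Some (inr ord0)
  | None, inr _ => Some q
  end.

Definition counter_graph := automaton_graph delta.

Lemma counter_essential : essential counter_graph.
Proof.
apply: automaton_essential => q.
  case: q => [[[i v]|]|s].
  - by exists (inl (Some (i, v))), (Some (inl false)).
  - by exists (inl None), (Some (inl false)).
  by exists (inr s), None.
case: q => [[[i v]|]|s].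
- by exists (Some (inl false)), (inl (Some (i, v))).
- by exists (Some (inl false)), (inl None).
by exists None, (inr s).
Qed.

Lemma run_base u : run delta (inl None) (map Some u) = Some (inl None).
Proof. by elim: u. Qed.

Lemma run_column u i v :
  run delta (inl (Some (i, v))) (map Some u) =
  Some (inl (Some (i, column u i v))).
Proof. by elim: u v => //= x u IHu v; rewrite IHu. Qed.

Lemma run_sink s w :
  run delta (inr s) w = if has isSome w then None else Some (inr s).
Proof. by elim: w => //= -[a|] w IHw. Qed.

Lemma split_at_finish (w : seq (option command)) :
  (exists u, w = map Some u) \/ exists u w', w = map Some u ++ None :: w'.
Proof.
elim: w => [|[x|] w IHw]; first by left; exists [::].
  case: IHw => [[u ->]|[u [w' ->]]]; first by left; exists (x :: u).
  by right; exists (x :: u), w'.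
by right; exists [::], w.
Qed.

Lemma synchronizing_size (w : seq (option command)) :
  @synchronizing counter_graph w -> N < size w.
Proof.
case/cards1P=> r Er.
have mem_end q q' : run delta q w = Some q' -> q' = r.
  by move=> Eq; apply/set1P; rewrite -Er; apply/end_verticesP; exists q.
have [[u Ew]|[u [w' Ew]]] := split_at_finish w.
  (* Without the letter [None], the base state and the column states survive and never meet. *)
  have := mem_end (inl None) (inl None); rewrite Ew run_base => /(_ erefl) Er1.
  have := mem_end (inl (Some (i0, None))); rewrite Ew run_column.
  by move=> /(_ _ erefl); rewrite -Er1.
(* After the first [None] only sinks are left, and any command would kill them all. *)
have w'None : has isSome w' = false.
  have /end_verticesP[q] : r \in @end_vertices counter_graph w.
    by rewrite Er inE.
  rewrite Ew run_cat; case: (run _ q _) => [[[[i v]|]|s]|] //=;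
    first case: ifP => //= _; by rewrite run_sink; case: has.
rewrite Ew size_cat size_map addnS ltnS.
apply: leq_trans (leq_addr _ _); apply: column_last_size => i v.
(* The base state ends in [inr ord0], so a column state spared by [None] would add the distinct end
   [inr ord_max]. *)
have := mem_end (inl None) (inr ord0).
rewrite Ew run_cat run_base /= run_sink w'None => /(_ erefl) Er1.
have := mem_end (inl (Some (i, v))) (inr ord_max).
rewrite Ew run_cat run_column /=; case: eqP => //= _.
by rewrite run_sink w'None -Er1 => /(_ erefl).
Qed.

Lemma counter_synchronizing : exists w, @synchronizing counter_graph w.
Proof.
have [u u_neq0 Eu] := column_reach ord_max.
exists (rcons (map Some u) None : seq (letter counter_graph)).
apply/cards1P; exists (inr ord0 : vertex counter_graph); apply/setP => r.
rewrite inE -cats1; apply/end_verticesP/eqP => [[q]|->]; last first.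
  by exists (inl None); rewrite run_cat run_base.
rewrite run_cat; case: q => [[[i v]|]|s].
- by rewrite run_column /= Eu eqxx.
- by rewrite run_base /= => -[].
by rewrite run_sink; case: u u_neq0 {Eu}.
Qed.

Lemma counter_min_sync_length :
  exists2 m, is_min_sync_length counter_graph m & N < m.
Proof.
have ex_len : exists m,
    `[< exists2 w, @synchronizing counter_graph w & size w = m >].
  have [w sync_w] := counter_synchronizing.
  by exists (size w); apply/asboolP; exists w.
have [m /asboolP ex_m min_m] := ex_minnP ex_len; exists m; last first.
  by have [w /synchronizing_size ? <-] := ex_m.
by split=> // w sync_w; apply: min_m; apply/asboolP; exists w.
Qed.

Lemma card_counter_vertex : #|vertex counter_graph| = 3 * #|I| + p + 3.
Proof.
rewrite /= card_sum !card_option card_prod card_option card_bool card_ord.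
by rewrite mulnC !addnS addn0.
Qed.

End Counter.

(** * Choice of parameters and asymptotics *)

Lemma exp_sync_length_graph (n : nat) :
  exists G : labeled_graph,
    [/\ essential G, deterministic G, 5 < n -> #|vertex G| = n &
    exists2 m, is_min_sync_length G m &
      exists2 k, n <= 8 * k & 2 ^ k <= m].
Proof.
(* Each of the [k.+1] columns has 3 states, the base state and two sinks make 3 more, and
   [(n - 6) %% 3] idle sinks complete the count to [n]. *)
pose k := (n - 6) %/ 3; pose N := (2 ^ k.+1).-1.
have NE : N.+1 = #|{ffun 'I_k.+1 -> bool}|.
  by rewrite card_ffun card_bool card_ord prednK ?expn_gt0.
pose code (j : 'I_N.+1) : {ffun 'I_k.+1 -> bool} := enum_val (cast_ord NE j).
have code_inj : injective code by move=> i j /enum_val_inj/cast_ord_inj.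
exists (counter_graph ((n - 6) %% 3) code); split.
- exact: counter_essential.
- exact: automaton_deterministic.
- by rewrite card_counter_vertex card_ord /k; lia.
have [m min_m lt_m] := counter_min_sync_length ord0 ((n - 6) %% 3) code_inj.
(* The division gives [n <= 3 * k + 8], hence the constant 8, also for small [n], where [k] is 0. *)
exists m => //; exists k.+1; first by rewrite /k; lia.
by move: lt_m; rewrite /N prednK // expn_gt0.
Qed.

Local Open Scope classical_set_scope.
Local Open Scope ring_scope.

Theorem theorem5p2 (R : realType) :
  exists G : nat -> labeled_graph,
    (forall n : nat, essential (G n) /\ deterministic (G n)) /\
    exists2 f : nat -> R,
      f \is 'Omega_\oo (fun n : nat => n%:R : R) &
      \forall n \near \oo,
        #|vertex (G n)| = n /\
        exists2 m : nat, is_min_sync_length (G n) m & m%:R = 2 `^ (f n).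
Proof.
have [G GP] := choice exp_sync_length_graph.
exists G; split; first by move=> n; have [] := GP n.
have /choice[m mP] : forall n, exists m, is_min_sync_length (G n) m /\
    exists2 k, (n <= 8 * k)%N & (2 ^ k <= m)%N.
  by move=> n; have [_ _ _ [m]] := GP n; exists m.
have ln2_gt0 : 0 < ln 2 :> R by rewrite ln_gt0 // ltr1n.
have m_gt0 n : (0 < m n)%N.
  by have [_ [k _]] := mP n; apply: leq_trans; rewrite expn_gt0.
(* The exponent is the base 2 logarithm of the minimum length, which is at least [n / 8]. *)
exists (fun n => ln (m n)%:R / ln 2).
  rewrite qualifE; apply/asboolP; exists (8%:R^-1); first by rewrite invr_gt0.
  near=> n; have [_ [k le_n le_m]] := mP n.
  rewrite ler_pdivrMl // normr_nat.
  apply: (@le_trans _ _ (8 * k)%:R); first by rewrite ler_nat.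
  rewrite natrM ler_pM2l //; apply: le_trans (ler_norm _).
  rewrite ler_pdivlMr // mulr_natl -lnXn // ler_ln ?posrE ?exprn_gt0 ?ltr0n //.
  by rewrite -natrX ler_nat.
exists 6%N => // n /= le_n; split; first by have [_ _ ->] := GP n.
exists (m n); first by have [] := mP n.
rewrite /powR pnatr_eq0 /= divfK ?gt_eqF // lnK //.
by rewrite posrE ltr0n.
Unshelve. all: by end_near.
Qed.
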